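(* Let $V$ be a braided vector space over $\mathbb{C}$ such that $H_i(B_n,V^{\otimes n})$ has homological vanishing of slope $s$. Then, for any $\epsilon>0$, there exist integers $N\ge 2$ and $I\ge 0$ such that $H_i(B_n,V^{\otimes n})$ vanishes in the $(N,I)$ staircase and $\frac{I+1}{N+1}>s-\epsilon$. In particular, computing the finitely many homology groups in this $(N,I)$ staircase, and applying the fact that vanishing in an $(N,I)$ staircase implies homological vanishing with slope $\frac{I+1}{N+1}$, proves that $H_i(B_n,V^{\otimes n})$ has homological vanishing with slope $>s-\epsilon$.
   Context: A braided vector space $(V,R)$ over $\mathbb{C}$ is a finite-dimensional $\mathbb{C}$-vector space $V$ with a linear isomorphism $R\colon V\otimes V\to V\otimes V$ satisfying $(R\otimes \mathrm{id})(\mathrm{id}\otimes R)(R\otimes \mathrm{id})=(\mathrm{id}\otimes R)(R\otimes \mathrm{id})(\mathrm{id}\otimes R)$. $B_n$ is the Artin braid group on $n$ strands with standard generators $\sigma_1,\dots,\sigma_{n-1}$; it acts on $V^{\otimes n}$ with $\sigma_j$ acting by $R$ on the $j$-th and $(j+1)$-th tensor factors. $H_i(B_n,V^{\otimes n})$ is group homology; $n\ge 1$ and $i\ge 0$ are integers. $H_i(B_n,V^{\otimes n})$ has homological vanishing of slope $s$ (vanishes with slope $s$) if there is a constant $t$ such that $H_i(B_n,V^{\otimes n})=0$ for all $(n,i)$ with $i\le sn+t$. For integers $N\ge 2$, $I\ge 0$, it vanishes in the $(N,I)$ staircase if $H_i(B_n,V^{\otimes n})=0$ for all $(n,i)$ with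 $n\le N$ and $i\le I+n-N$.
   Formalization: The slope s is assumed to satisfy 0 < s ≤ 1; without this the claim fails (V = C with identity braiding for s ≤ 0; V = C with braiding a scalar that is not a root of unity for s > 1 and small ε). *)

(* Defs.v *)
From HB Require Import structures.
From mathcomp Require Import all_boot all_order all_algebra.
From mathcomp Require Import ring_quotient zify.
From mathcomp Require Import finmap boolp reals.
From mathcomp.multinomials Require Import monalg.
From mathcomp.real_closed Require Import complex.

Set Implicit Arguments.
Unset Strict Implicit.
Unset Printing Implicit Defensive.

Import GRing.Theory.
Local Open Scope ring_scope.
Local Open Scope quotient_scope.

Record representation (G : groupType) (k : nzRingType) (M : lmodType k) :=
  Representation {
    raction :> G -> {linear M -> M};
    raction1 : forall x, raction 1%g x = x;
    ractionM : forall g h x, raction (g * h)%g x = raction g (raction h x)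
  }.

Section GroupHomology.
Variables (G : groupType) (k : nzRingType) (M : lmodType k).
Variable rho : representation G M.

(* The inhomogeneous bar complex: [chain i] is the direct sum of copies of M
   indexed by G^i, i.e. M tensored with the free module on symbols [g1|...|gi];
   [<< m *g g >>] is the generator m[g1|...|gi]. *)
Definition chain i := {malg M[{ffun 'I_i -> G}]}.

(* [bar_face j] deletes g1 if j = 0, deletes g_(i+1) if j = i+1, and
   multiplies g_j by g_(j+1) otherwise; [g (lift ord_max a)] and
   [g (lift ord0 a)] are two consecutive entries of g. *)
Definition bar_face i (j : 'I_i.+2) (g : {ffun 'I_i.+1 -> G}) :
    {ffun 'I_i -> G} :=
  [ffun a : 'I_i => if (a.+1 < j)%N then g (lift ord_max a)
                    else if a.+1 == j then (g (lift ord_max a) * g (lift ord0 a))%g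
                    else g (lift ord0 a)].

(* M is a left module, hence a right module through g^-1; this is the right
   action of g1 on the coefficient in the face j = 0. *)
Definition bar_coef i (j : 'I_i.+2) (g : {ffun 'I_i.+1 -> G}) (m : M) : M :=
  if j == ord0 then rho (g ord0)^-1%g m else m.

Definition bar_diff i (x : chain i.+1) : chain i :=
  \sum_(g <- msupp x) \sum_(j < i.+2)
    << (-1) ^+ j *: bar_coef j g x@_g *g bar_face j g >>.

Lemma bar_diffEw i (x : chain i.+1) (D : {fset {ffun 'I_i.+1 -> G}}) :
  (msupp x `<=` D)%fset ->
  bar_diff x = \sum_(g <- D) \sum_(j < i.+2)
    << (-1) ^+ j *: bar_coef j g x@_g *g bar_face j g >>.
Proof.
move=> xD; rewrite /bar_diff (big_fset_incl _ xD) //= => g _ xg.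
rewrite big1 // => j _; rewrite mcoeff_outdom //.
by rewrite /bar_coef raddf0 if_same scaler0 monalgU0.
Qed.

Lemma bar_coefB i (j : 'I_i.+2) g x y :
  bar_coef j g (x - y) = bar_coef j g x - bar_coef j g y.
Proof. by rewrite /bar_coef; case: ifP => // _; rewrite raddfB. Qed.

Lemma bar_coefZ i (j : 'I_i.+2) g a x :
  bar_coef j g (a *: x) = a *: bar_coef j g x.
Proof. by rewrite /bar_coef; case: ifP => // _; rewrite linearZ. Qed.

Lemma bar_diff_is_additive i : zmod_morphism (@bar_diff i).
Proof.
move=> x y; pose D := (msupp x `|` msupp y)%fset.
have xD : (msupp x `<=` D)%fset by rewrite fsubsetUl.
have yD : (msupp y `<=` D)%fset by rewrite fsubsetUr.
rewrite (bar_diffEw (msuppB_le x y)) (bar_diffEw xD) (bar_diffEw yD) -sumrB.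
apply: eq_bigr => g _; rewrite -sumrB; apply: eq_bigr => j _.
by rewrite raddfB /= bar_coefB scalerBr monalgUB.
Qed.

HB.instance Definition _ i := GRing.isZmodMorphism.Build (chain i.+1) (chain i)
  (@bar_diff i) (@bar_diff_is_additive i).

Lemma bar_diffU i m (g : {ffun 'I_i.+1 -> G}) :
  bar_diff << m *g g >> = \sum_(j < i.+2)
    << (-1) ^+ j *: bar_coef j g m *g bar_face j g >>.
Proof.
rewrite (bar_diffEw (D := [fset g]%fset)) ?msuppU_le //.
by rewrite big_seq_fset1 mcoeffUU.
Qed.

Lemma bar_simplicial i (j l' : 'I_i.+3) (l j' : 'I_i.+2)
    (g : {ffun 'I_i.+2 -> G}) :
  (l < j)%N -> j'.+1 = j -> l' = l :> nat ->
  bar_face l (bar_face j g) = bar_face j' (bar_face l' g).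
Proof.
move=> lj ej el; apply/ffunP => a; rewrite !ffunE.
pose c n := g (inord n); have gE b : g b = c b by rewrite /c inord_val.
rewrite !gE /= /bump !leq0n !add1n -ej el.
have ai := ltn_ord a.
have -> : (i <= a)%N = false by lia.
have -> : (i < a.+1)%N = false by lia.
rewrite !add0n; have -> : (i < a)%N = false by lia.
rewrite !add0n !eqSS !ltnS.
have lj' : (l <= j')%N by rewrite -ltnS ej.
case: (ltngtP a.+1 l) => h1; case: (ltngtP a j') => h2;
  case: (ltngtP a.+1 j') => h3; case: (ltngtP a.+2 l) => h4 /=;
  rewrite ?mulgA //; lia.
Qed.

Lemma bar_coefK i (j l' : 'I_i.+3) (l j' : 'I_i.+2) g m :
  (l < j)%N -> j'.+1 = j -> l' = l :> nat ->
  bar_coef l (bar_face j g) (bar_coef j g m) =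
  bar_coef j' (bar_face l' g) (bar_coef l' g m).
Proof.
move=> lj ej el; rewrite /bar_coef -!val_eqE /= -ej el /= !ffunE /= -ej el !eqSS.
case: (posnP l) => [l0|l0]; last first.
  have -> // : (j' == 0 :> nat) = false by lia.
rewrite !l0 ltnS /= [0%N == j']eq_sym.
case: (posnP j') => [j0|j0] /=; last first.
  congr (rho (g _)^-1%g m); exact: val_inj.
rewrite -ractionM -invgM. 
by congr (rho (g _ * g _)^-1%g m); exact: val_inj.
Qed.

Lemma bar_diffUK i m (g : {ffun 'I_i.+2 -> G}) :
  bar_diff (bar_diff << m *g g >>) = 0.
Proof.
rewrite bar_diffU raddf_sum /=.
under eq_bigr do rewrite bar_diffU.
rewrite pair_big /=.
rewrite (bigID (fun p : 'I_i.+3 * 'I_i.+2 => (p.2 < p.1)%N)) /=.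
pose h (p : 'I_i.+3 * 'I_i.+2) : 'I_i.+3 * 'I_i.+2 :=
  (inord p.2, inord p.1.-1).
pose h' (p : 'I_i.+3 * 'I_i.+2) : 'I_i.+3 * 'I_i.+2 :=
  (inord p.2.+1, inord p.1).
rewrite (reindex_onto h' h) /=; last first.
  case=> a b /= ba; rewrite /h /h' /=; congr pair; apply: val_inj; rewrite /= !inordK //=;
    have := ltn_ord a; have := ltn_ord b; lia.
rewrite [X in X + _](eq_bigl (fun p : 'I_i.+3 * 'I_i.+2 => ~~ (p.2 < p.1)%N)); last first.
  case=> a b /=; rewrite -leqNgt.
  have ha := ltn_ord a; have hb := ltn_ord b.
  rewrite [inord b.+1 : nat]inordK ?ltnS //.
  have [ab|ab] := leqP a b.
    have ai : (a < i.+2)%N by exact: leq_ltn_trans ab hb.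
    rewrite inordK // ab /=.
    by apply/eqP; congr pair; apply: val_inj; rewrite /= !inordK.
  apply/negP => /andP[+ /eqP[e1 _]].
  have [hai|hai] := leqP a i.+1; first by rewrite inordK //; lia.
  have : nat_of_ord (inord (inord a : 'I_i.+2) : 'I_i.+3) = a by rewrite e1.
  have hc := ltn_ord (inord a : 'I_i.+2).
  by rewrite inordK; lia.
rewrite -big_split /= big1 // => -[a b] /=; rewrite -leqNgt => ab.
have ha := ltn_ord a; have hb := ltn_ord b.
set j : 'I_i.+3 := inord b.+1; set l : 'I_i.+2 := inord a.
have ej : b.+1 = j by rewrite inordK.
have el : a = l :> nat by rewrite inordK //; lia.
have lj : (l < j)%N by lia.
have eF := bar_simplicial g lj ej el; have eC := bar_coefK g m lj ej el.
rewrite !bar_coefZ !scalerA -!exprD eF eC -monalgUD -scalerDl -ej -el.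
by rewrite addnS exprS mulN1r addnC addNr scale0r monalgU0.
Qed.

Lemma bar_diffK i (x : chain i.+2) : bar_diff (bar_diff x) = 0.
Proof.
rewrite {1}[x]monalgE (raddf_sum (@bar_diff i.+1)) (raddf_sum (@bar_diff i)).
by rewrite big1_seq // => g _; exact: bar_diffUK.
Qed.

Definition is_cycle i : {pred chain i} :=
  match i return {pred chain i} with
  | 0 => predT
  | i'.+1 => fun x => bar_diff x == 0
  end.

Definition is_boundary i : {pred chain i} :=
  fun x => `[< exists y : chain i.+1, bar_diff y = x >].

Lemma is_cycle_zmod_closed i : zmod_closed (@is_cycle i).
Proof.
case: i => [|i]; split => //.
  by rewrite unfold_in /= raddf0.
move=> x y; rewrite !unfold_in /= => /eqP ex /eqP ey.
by rewrite raddfB /= ex ey subrr.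
Qed.

HB.instance Definition _ i :=
  GRing.isZmodClosed.Build (chain i) (@is_cycle i) (@is_cycle_zmod_closed i).

Record cycles i := Cycles { cycle_chain : chain i; _ : is_cycle cycle_chain }.

HB.instance Definition _ i := [isSub for @cycle_chain i].
HB.instance Definition _ i := [Choice of cycles i by <:].
HB.instance Definition _ i := [SubChoice_isSubZmodule of cycles i by <:].

Definition boundaries i : {pred cycles i} := fun z => is_boundary (val z).

Lemma boundaries_zmod_closed i : zmod_closed (@boundaries i).
Proof.
split; first by rewrite unfold_in; apply/asboolP; exists 0; rewrite !raddf0.
move=> x y; rewrite !unfold_in => /asboolP[x' ex] /asboolP[y' ey].
by apply/asboolP; exists (x' - y'); rewrite !raddfB /= ex ey.
Qed.

HB.instance Definition _ i :=
  GRing.isZmodClosed.Build (cycles i) (@boundaries i) (@boundaries_zmod_closed i).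

Definition group_homology i : zmodType := Quotient.quot (@boundaries i).

End GroupHomology.

Section BraidGroup.
Variable n : nat.

(* A word in the sigma_j^(+-1), 1 <= j <= n-1; [(j, true)] stands for
   sigma_(j+1) and [(j, false)] for its inverse. *)
Definition braid_word := seq ('I_n.-1 * bool).

Inductive braid_eq : braid_word -> braid_word -> Prop :=
| braid_eq_refl w : braid_eq w w
| braid_eq_sym w1 w2 : braid_eq w1 w2 -> braid_eq w2 w1
| braid_eq_trans w1 w2 w3 : braid_eq w1 w2 -> braid_eq w2 w3 -> braid_eq w1 w3
| braid_eq_cat w1 w1' w2 w2' :
    braid_eq w1 w1' -> braid_eq w2 w2' -> braid_eq (w1 ++ w2) (w1' ++ w2')
| braid_eq_inv j b : braid_eq [:: (j, b); (j, ~~ b)] [::]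
| braid_eq_far (j k : 'I_n.-1) : (j.+1 < k)%N ->
    braid_eq [:: (j, true); (k, true)] [:: (k, true); (j, true)]
| braid_eq_braid (j k : 'I_n.-1) : k = j.+1 :> nat ->
    braid_eq [:: (j, true); (k, true); (j, true)]
             [:: (k, true); (j, true); (k, true)].

Definition braid_eqb (w1 w2 : braid_word) : bool := `[< braid_eq w1 w2 >].

Lemma braid_eqb_equiv : equiv_class_of braid_eqb.
Proof.
split=> [w|w1 w2|w2 w1 w3].
- exact/asboolP/braid_eq_refl.
- by apply/asboolP/asboolP; apply: braid_eq_sym.
- by move=> /asboolP h1 /asboolP h2; exact/asboolP/(braid_eq_trans h1 h2).
Qed.

Canonical braid_equiv := EquivRelPack braid_eqb_equiv.
Canonical braid_encModRel := defaultEncModRel braid_eqb.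

Definition braid_group := {eq_quot braid_eqb}.
HB.instance Definition _ := Choice.on braid_group.
HB.instance Definition _ := EqQuotient.on braid_group.

Definition braid_class (w : braid_word) : braid_group := \pi_braid_group w.

Lemma braid_classP w1 w2 : braid_class w1 = braid_class w2 <-> braid_eq w1 w2.
Proof.
split=> [/eqquotP /asboolP //|h].
by apply/eqquotP; exact/asboolP.
Qed.

Lemma braid_repr w : braid_eq (repr (braid_class w)) w.
Proof. by apply/braid_classP; rewrite /braid_class reprK. Qed.

Lemma braid_class_repr (g : braid_group) : braid_class (repr g) = g.
Proof. exact: reprK. Qed.

Definition word_inv (w : braid_word) : braid_word :=
  rev [seq (l.1, ~~ l.2) | l <- w].

Lemma word_invK : involutive word_inv.
Proof.
move=> w; rewrite /word_inv map_rev revK -map_comp -[RHS]map_id.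
by apply: eq_map => -[j b] /=; rewrite negbK.
Qed.

Lemma word_invV w : braid_eq (w ++ word_inv w) [::].
Proof.
elim: w => [|[j b] w IH]; first exact: braid_eq_refl.
have -> : ((j, b) :: w) ++ word_inv ((j, b) :: w) =
    [:: (j, b)] ++ (w ++ word_inv w) ++ [:: (j, ~~ b)].
  by rewrite /word_inv /= rev_cons -cats1 -catA.
apply: braid_eq_trans (braid_eq_inv j b).
apply: (@braid_eq_cat _ [:: (j, b)] _ [:: (j, ~~ b)]).
  exact: braid_eq_refl.
by apply: (@braid_eq_cat _ [::]) => //; exact: braid_eq_refl.
Qed.

Definition braid_one : braid_group := braid_class [::].
Definition braid_mul (g h : braid_group) : braid_group :=
  braid_class (repr g ++ repr h).
Definition braid_inv (g : braid_group) : braid_group :=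
  braid_class (word_inv (repr g)).

Lemma braid_class_cat w1 w2 :
  braid_class (w1 ++ w2) = braid_mul (braid_class w1) (braid_class w2).
Proof.
apply/braid_classP; apply: braid_eq_cat; apply: braid_eq_sym; exact: braid_repr.
Qed.

Lemma braid_mulA : associative braid_mul.
Proof.
move=> g h l; rewrite -[g]braid_class_repr -[h]braid_class_repr.
by rewrite -[l]braid_class_repr -!braid_class_cat catA.
Qed.

Lemma braid_mul1g : left_id braid_one braid_mul.
Proof.
by move=> g; rewrite -[g]braid_class_repr -braid_class_cat.
Qed.

Lemma braid_mulg1 : right_id braid_one braid_mul.
Proof.
by move=> g; rewrite -[g]braid_class_repr -braid_class_cat cats0.
Qed.

Lemma braid_mulgV : right_inverse braid_one braid_inv braid_mul.
Proof.
move=> g; rewrite -{1}[g]braid_class_repr -braid_class_cat.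
by apply/braid_classP; exact: word_invV.
Qed.

Lemma braid_mulVg : left_inverse braid_one braid_inv braid_mul.
Proof.
move=> g; rewrite -{2}[g]braid_class_repr -braid_class_cat.
by apply/braid_classP; rewrite -{2}[repr g]word_invK; exact: word_invV.
Qed.

HB.instance Definition _ := isGroup.Build braid_group
  braid_mulA braid_mul1g braid_mulg1 braid_mulVg braid_mulgV.

Definition braid_gen (j : 'I_n.-1) : braid_group := braid_class [:: (j, true)].

End BraidGroup.

Section TensorPower.
Variables (k : fieldType) (V : vectType k).

(* The n-th tensor power of V is given by coordinates: [x f] is the coefficient
   of e_(f 0) (x) ... (x) e_(f (n-1)), for the basis e = [vbasis {:V}] of V. *)
Definition tidx n := {ffun 'I_n -> 'I_(\dim {:V})}.
Definition tpow n := {ffun tidx n -> k^o}.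
HB.instance Definition _ n := Vector.on (tpow n).

Definition tprod n (v : 'I_n -> V) : tpow n :=
  [ffun f : tidx n => \prod_i coord (vbasis {:V}) (f i) (v i)].

Lemma tprod_basis n (f : tidx n) :
  tprod (fun i => (vbasis {:V})`_(f i)) = [ffun g => (g == f)%:R].
Proof.
apply/ffunP => g; rewrite !ffunE.
have fr : free (vbasis {:V}) by exact: basis_free (vbasisP _).
under eq_bigr do rewrite coord_free //.
case: eqP => [->|/eqP ne].
  by rewrite big1 // => i _; rewrite eqxx.
have [i ne_i] : exists i, f i != g i.
  apply/existsP; apply: contraNT ne; rewrite negb_exists => /forallP h.
  by apply/eqP/ffunP => i; apply/eqP; have := h i; rewrite negbK eq_sym.
by rewrite (bigD1 i) //=; move: ne_i; rewrite -val_eqE eq_sym /= => /negbTE ->; rewrite mul0r.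
Qed.

Lemma tprod_linear n (v : 'I_n -> V) (i : 'I_n) (a : k) (u w : V) :
  let vi z := fun j => if j == i then z else v j in
  tprod (vi (a *: u + w)) = a *: tprod (vi u) + tprod (vi w).
Proof.
move=> vi; apply/ffunP => f; rewrite !ffunE /vi.
rewrite (bigD1 i) //= [in X in _ = _ *: X + _](bigD1 i) //=.
rewrite [in X in _ = _ + X](bigD1 i) //= !eqxx.
have E z : \prod_(j < n | j != i) coord (vbasis {:V}) (f j) (if j == i then z else v j)
   = \prod_(j < n | j != i) coord (vbasis {:V}) (f j) (v j).
  by apply: eq_bigr => j /negbTE ->.
by rewrite !E linearP mulrDl /= /GRing.scale /= mulrA.
Qed.

(* [tblock] reads the m factors starting at position j, [tupd] overwrites
   them. *)
Definition tblock n m j (le_n : (j + m <= n)%N) (f : tidx n) : tidx m :=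
  [ffun q => f (widen_ord le_n (rshift j q))].

Definition tupd n m (j : nat) (f : tidx n) (a : tidx m) : tidx n :=
  [ffun p : 'I_n => if (p < j)%N then f p
                    else if insub (p - j)%N is Some q then a q else f p].

Lemma tupdE n m j (f : tidx n) (a : tidx m) (p : 'I_n) (q : 'I_m) :
  p = (j + q)%N :> nat -> tupd j f a p = a q.
Proof.
move=> e; rewrite ffunE e ltnNge leq_addr /= addKn.
by rewrite insubT //= => h; congr (a _); apply: val_inj.
Qed.

Lemma tupd_out n m j (f : tidx n) (a : tidx m) (p : 'I_n) :
  (p < j)%N || (j + m <= p)%N -> tupd j f a p = f p.
Proof.
move=> h; rewrite ffunE; case: ltnP h => //= jp h.
by rewrite insubF //; lia.
Qed.

Lemma tblock_upd n m j (le_n : (j + m <= n)%N) (f : tidx n) (a : tidx m) :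
  tblock le_n (tupd j f a) = a.
Proof. by apply/ffunP => q; rewrite ffunE (@tupdE _ _ _ _ _ _ (q)). Qed.

Lemma tupd_block n m j (le_n : (j + m <= n)%N) (f : tidx n) :
  tupd j f (tblock le_n f) = f.
Proof.
apply/ffunP => p.
have [h|/norP[h1 h2]] := boolP ((p < j)%N || (j + m <= p)%N).
  by rewrite tupd_out.
have hq : (p - j < m)%N by lia.
rewrite (@tupdE _ _ _ _ _ _ (Ordinal hq)) /=; last by lia.
by rewrite ffunE; congr (f _); apply: val_inj => /=; lia.
Qed.

Lemma tupd_upd n m j (f : tidx n) (a b : tidx m) :
  tupd j (tupd j f a) b = tupd j f b.
Proof.
apply/ffunP => p; rewrite !ffunE; case: ltnP => //= jp.
by case: insubP.
Qed.

(* A coordinate version of id^(j) (x) T (x) id^(n-j-m). *)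
Definition tlocal n m j (le_n : (j + m <= n)%N) (T : tpow m -> tpow m)
    (x : tpow n) : tpow n :=
  [ffun f : tidx n => T [ffun a : tidx m => x (tupd j f a)] (tblock le_n f)].

Lemma tlocal_linear n m j (le_n : (j + m <= n)%N) (T : {linear tpow m -> tpow m}) :
  linear (tlocal le_n T).
Proof.
move=> c x y; apply/ffunP => f; rewrite !ffunE.
have -> : [ffun a => (c *: x + y) (tupd j f a)] =
  c *: [ffun a => x (tupd j f a)] + [ffun a => y (tupd j f a)] :> tpow m.
  by apply/ffunP => a; rewrite !ffunE.
by rewrite linearP !ffunE.
Qed.

HB.instance Definition _ n m j (le_n : (j + m <= n)%N)
    (T : {linear tpow m -> tpow m}) :=
  GRing.isLinear.Build k (tpow n) (tpow n) *:%R (tlocal le_n T)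
    (tlocal_linear le_n T).

Lemma prod_tblock n m j (le_n : (j + m <= n)%N) (F : 'I_n -> k) :
  \prod_p F p = \prod_(p < n | (p < j)%N || (j + m <= p)%N) F p *
                \prod_(q < m) F (widen_ord le_n (rshift j q)).
Proof.
rewrite (bigID (fun p : 'I_n => (p < j)%N || (j + m <= p)%N)) /=; congr (_ * _).
pose h' (p : 'I_n) : option 'I_m := if (j <= p)%N then insub (p - j)%N else None.
rewrite (reindex_omap (fun q => widen_ord le_n (rshift j q)) h') /=; last first.
  move=> p /norP[h1 h2]; rewrite /h'; have -> : (j <= p)%N by lia.
  rewrite insubT /=; first by lia.
  by move=> h; congr Some; apply: val_inj => /=; lia.
apply: eq_bigl => q; rewrite /h' /= leq_addr addKn valK eqxx andbT.
by have := ltn_ord q; lia.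
Qed.

(* On pure tensors, T acts on the factors at positions j, ..., j+m-1. *)
Lemma tlocal_tprod n m j (le_n : (j + m <= n)%N) (T : {linear tpow m -> tpow m})
    (v : 'I_n -> V) :
  tlocal le_n T (tprod v) =
  \sum_a T (tprod (fun q => v (widen_ord le_n (rshift j q)))) a *:
    tprod (fun p : 'I_n => if (p < j)%N then v p
                    else if insub (p - j)%N is Some q
                         then (vbasis {:V})`_(a q) else v p).
Proof.
apply/ffunP => f; rewrite ffunE sum_ffunE.
pose w := fun q => v (widen_ord le_n (rshift j q)).
pose P := \prod_(p < n | (p < j)%N || (j + m <= p)%N) coord (vbasis {:V}) (f p) (v p).
have -> : [ffun a : tidx m => tprod v (tupd j f a)] = P *: tprod w.
  apply/ffunP => a; rewrite !ffunE (prod_tblock le_n); congr (_ * _).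
    by apply: eq_bigr => p hp; rewrite tupd_out.
  by apply: eq_bigr => q _; rewrite (@tupdE _ _ _ _ _ _ q).
rewrite linearZ ffunE /= (bigD1 (tblock le_n f)) //= [X in _ = _ + X]big1 ?addr0; last first.
  move=> a ne; rewrite !ffunE; apply/eqP; rewrite scaler_eq0; apply/orP; right.
  have [q neq] : exists q, a q != tblock le_n f q.
    apply/existsP; apply: contraNT ne; rewrite negb_exists => /forallP h.
    by apply/eqP/ffunP => q; apply/eqP; have := h q; rewrite negbK.
  rewrite (prod_tblock le_n) [X in _ * X](bigD1 q) //= ltnNge leq_addr /= addKn valK.
  rewrite coord_free ?(basis_free (vbasisP _)) //.
  by move: neq; rewrite ffunE -val_eqE eq_sym /= => /negbTE ->; rewrite mul0r mulr0.
rewrite !ffunE [LHS]mulrC; congr (_ * _).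
rewrite (prod_tblock le_n) [X in _ * X]big1 ?mulr1.
  apply: eq_bigr => p; case: ltnP => //= pj hp.
  by rewrite insubF //; lia.
move=> q _; rewrite /= ltnNge leq_addr /= addKn valK.
by rewrite coord_free ?(basis_free (vbasisP _)) // ffunE eqxx.
Qed.

Lemma tlocal_slice n m j (le_n : (j + m <= n)%N) T (x : tpow n) (f : tidx n) :
  [ffun a : tidx m => tlocal le_n T x (tupd j f a)] =
  T [ffun a : tidx m => x (tupd j f a)].
Proof.
apply/ffunP => a; rewrite !ffunE tblock_upd; congr (T _ a).
by apply/ffunP => b; rewrite !ffunE tupd_upd.
Qed.

Lemma tlocal_comp n m j (le_n : (j + m <= n)%N) T T' (x : tpow n) :
  tlocal le_n T (tlocal le_n T' x) = tlocal le_n (T \o T') x.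
Proof. by apply/ffunP => f; rewrite !ffunE tlocal_slice. Qed.

Lemma eq_tlocal n m j (le_n : (j + m <= n)%N) T T' (x : tpow n) :
  T =1 T' -> tlocal le_n T x = tlocal le_n T' x.
Proof. by move=> eT; apply/ffunP => f; rewrite !ffunE eT. Qed.

Lemma tlocal_id n m j (le_n : (j + m <= n)%N) T (x : tpow n) :
  T =1 id -> tlocal le_n T x = x.
Proof. by move=> eT; apply/ffunP => f; rewrite !ffunE eT ffunE tupd_block. Qed.

Lemma tlocal_nested n m p j l (le_n : (j + m <= n)%N) (le_m : (l + p <= m)%N)
    (le' : (j + l + p <= n)%N) T (x : tpow n) :
  tlocal le' T x = tlocal le_n (tlocal le_m T) x.
Proof.
apply/ffunP => f; rewrite !ffunE; congr (T _ _).
  apply/ffunP => a; rewrite !ffunE; congr (x _); apply/ffunP => q.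
  have [h|h] := boolP ((q < j)%N || (j + m <= q)%N).
    by rewrite !tupd_out //; lia.
  have hq : (q - j < m)%N by lia.
  rewrite [RHS](@tupdE _ _ _ _ _ _ (Ordinal hq)) /=; last by lia.
  have [h'|h'] := boolP ((q - j < l)%N || (l + p <= q - j)%N).
    rewrite !tupd_out //=; last by lia.
    by rewrite ffunE; congr (f _); apply: val_inj => /=; lia.
  have hr : (q - j - l < p)%N by lia.
  by rewrite !(@tupdE _ _ _ _ _ _ (Ordinal hr)) //=; lia.
by apply/ffunP => q; rewrite !ffunE; congr (f _); apply: val_inj => /=; lia.
Qed.

Lemma tpow_delta n (x : tpow n) :
  x = \sum_f x f *: [ffun g => (g == f)%:R : k^o].
Proof.
apply/ffunP => g; rewrite sum_ffunE (bigD1 g) //= !ffunE eqxx.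
rewrite [X in _ = _ + X]big1 ?addr0 ?/GRing.scale /= ?mulr1 //.
by move=> f /negbTE ne; rewrite !ffunE eq_sym ne /GRing.scale /= mulr0.
Qed.

Lemma tpow_linearE n m (T : {linear tpow n -> tpow m}) (z : tpow n) (d : tidx m) :
  T z d = \sum_a z a * T [ffun g => (g == a)%:R : k^o] d.
Proof.
rewrite {1}[z]tpow_delta linear_sum sum_ffunE; apply: eq_bigr => a _.
by rewrite linearZ ffunE.
Qed.

Lemma tlocal_far n m p j l (le_j : (j + m <= n)%N) (le_l : (l + p <= n)%N)
    (T : {linear tpow m -> tpow m}) (U : {linear tpow p -> tpow p}) (x : tpow n) :
  (j + m <= l)%N ->
  tlocal le_j T (tlocal le_l U x) = tlocal le_l U (tlocal le_j T x).
Proof.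
move=> jl; apply/ffunP => f; rewrite !ffunE.
rewrite tpow_linearE [RHS]tpow_linearE.
under eq_bigr do rewrite !ffunE tpow_linearE big_distrl /=.
under [RHS]eq_bigr do rewrite !ffunE tpow_linearE big_distrl /=.
rewrite exchange_big /=; apply: eq_bigr => b _; apply: eq_bigr => a _.
rewrite !ffunE mulrAC; congr (_ * _ * _).
- congr (x _); apply/ffunP => q.
  have [/andP[h1 h2]|h1] := boolP ((j <= q)%N && (q < j + m)%N).
    have hq : (q - j < m)%N by lia.
    rewrite tupd_out; last by lia.
    by rewrite !(@tupdE _ _ _ _ _ _ (Ordinal hq)) //=; lia.
  have [/andP[h2 h3]|h2] := boolP ((l <= q)%N && (q < l + p)%N).
    have hq : (q - l < p)%N by lia.
    rewrite [RHS]tupd_out; last by lia.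
    by rewrite !(@tupdE _ _ _ _ _ _ (Ordinal hq)) //=; lia.
  by rewrite !tupd_out //; lia.
- congr (T _ _); apply/ffunP => q; rewrite !ffunE /=.
  have -> : (j + q < l)%N by have := ltn_ord q; lia.
  by [].
- congr (U _ _); apply/ffunP => q; rewrite ffunE [RHS]ffunE tupd_out //=.
  by lia.
Qed.

End TensorPower.

Record braidedVectSpace (k : fieldType) := BraidedVectSpace {
  bvs_space :> vectType k;
  braiding : 'End(tpow bvs_space 2);
  braiding_bij : bijective braiding;
  yang_baxter : forall x : tpow bvs_space 3,
    let R_id := @tlocal _ bvs_space 3 2 0 isT braiding in
    let id_R := @tlocal _ bvs_space 3 2 1 isT braiding in
    R_id (id_R (R_id x)) = id_R (R_id (id_R x))
}.

Lemma braid_pos n (j : 'I_n.-1) : (j + 2 <= n)%N.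
Proof. by have := ltn_ord j; lia. Qed.

Section BraidAction.
Variables (k : fieldType) (V : braidedVectSpace k) (n : nat).

Local Notation R := (braiding V).

Lemma braiding_lker0 : lker R == 0%VS.
Proof. by apply/lker0P; exact: bij_inj (braiding_bij V). Qed.

Definition gen_act (l : 'I_n.-1 * bool) (x : tpow V n) : tpow V n :=
  tlocal (braid_pos l.1) (if l.2 then R else (R^-1)%VF) x.

Lemma gen_act_linear l : linear (gen_act l).
Proof. exact: tlocal_linear. Qed.

Fixpoint word_act (w : braid_word n) (x : tpow V n) : tpow V n :=
  if w is l :: w' then gen_act l (word_act w' x) else x.

Lemma word_act_linear w : linear (word_act w).
Proof. by elim: w => //= l w IH c x y; rewrite IH gen_act_linear. Qed.

Lemma word_act_cat w1 w2 x :
  word_act (w1 ++ w2) x = word_act w1 (word_act w2 x).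
Proof. by elim: w1 => //= l w1 ->. Qed.

Lemma gen_actVK j b x : gen_act (j, b) (gen_act (j, ~~ b) x) = x.
Proof.
rewrite /gen_act tlocal_comp /=; apply: tlocal_id => y /=.
by case: b => /=; rewrite (lker0_lfunK, lker0_lfunVK) // braiding_lker0.
Qed.

Lemma word_act_eq w1 w2 : braid_eq w1 w2 -> word_act w1 =1 word_act w2.
Proof.
elim=> {w1 w2} [//|w1 w2 _ IH x|w1 w2 w3 _ IH1 _ IH2 x|w1 w1' w2 w2' _ IH1 _ IH2 x
  |j b x|j l jl x|j l jl x].
- by rewrite IH.
- by rewrite IH1 IH2.
- by rewrite !word_act_cat IH2 IH1.
- exact: gen_actVK.
- by apply: tlocal_far => /=; lia.
- rewrite /= /gen_act /=.
  have le3 : (j + 3 <= n)%N by have := ltn_ord l; lia.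
  have le0 : (j + 0 + 2 <= n)%N by lia.
  have le1 : (j + 1 + 2 <= n)%N by lia.
  have E0 y : tlocal (braid_pos j) R y = tlocal le3 (@tlocal _ V 3 2 0 isT R) y.
    rewrite -(tlocal_nested _ _ le0); move: (braid_pos j) le0.
    by rewrite addn0 => h1 h2; congr tlocal; exact: bool_irrelevance.
  have E1 y : tlocal (braid_pos l) R y = tlocal le3 (@tlocal _ V 3 2 1 isT R) y.
    rewrite -(tlocal_nested _ _ le1); move: (braid_pos l) le1.
    by rewrite jl addn1 => h1 h2; congr tlocal; exact: bool_irrelevance.
  rewrite !E0 !E1 !tlocal_comp; apply: eq_tlocal => y.
  exact: yang_baxter.
Qed.

Definition braid_raction (g : braid_group n) : tpow V n -> tpow V n :=
  word_act (repr g).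

HB.instance Definition _ g := GRing.isLinear.Build k (tpow V n) (tpow V n) *:%R
  (braid_raction g) (word_act_linear (repr g)).

Lemma braid_raction_class w x : braid_raction (braid_class w) x = word_act w x.
Proof. exact/word_act_eq/braid_repr. Qed.

Lemma braid_raction1 x : braid_raction 1%g x = x.
Proof. exact: braid_raction_class. Qed.

Lemma braid_ractionM g h x :
  braid_raction (g * h)%g x = braid_raction g (braid_raction h x).
Proof. by rewrite braid_raction_class word_act_cat. Qed.

Definition braid_rep : representation (braid_group n) (tpow V n) :=
  Representation braid_raction1 braid_ractionM.

Lemma braid_rep_gen j x : braid_rep (braid_gen j) x = tlocal (braid_pos j) R x.
Proof. exact: braid_raction_class. Qed.

End BraidAction.

Definition braid_homology (k : fieldType) (V : braidedVectSpace k) (n i : nat) :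
    zmodType :=
  group_homology (braid_rep V n) i.

Definition homology_vanishes (k : fieldType) (V : braidedVectSpace k)
    (n i : nat) : Prop :=
  forall h : braid_homology V n i, h = 0.

Definition vanishes_with_slope (R : realType) (V : braidedVectSpace R[i])
    (s : R) : Prop :=
  exists t : R, forall n i : nat, (1 <= n)%N ->
    i%:R <= s * n%:R + t -> homology_vanishes V n i.

(* In int, since I + n - N may be negative. *)
Definition in_staircase (N I n i : nat) : Prop :=
  [/\ (1 <= n)%N, (n <= N)%N & i%:Z <= I%:Z + n%:Z - N%:Z].

Definition vanishes_in_staircase (k : fieldType) (V : braidedVectSpace k)
    (N I : nat) : Prop :=
  forall n i : nat, in_staircase N I n i -> homology_vanishes V n i.

(* Main.v *)
Require Import Defs.
From mathcomp Require Import all_boot all_order all_algebra.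
From mathcomp Require Import boolp classical_sets cardinality reals.
From mathcomp.real_closed Require Import complex.
From mathcomp Require Import zify lra.

Import Order.TTheory GRing.Theory Num.Theory.

Local Open Scope ring_scope.
Local Open Scope classical_set_scope.

(** If [H_i] vanishes for [i <= s n + t], take [N] large and
    [I = floor (s N - |t| - 1)]. Since [s <= 1], the line [i = I + n - N]
    bounding the staircase is at least as steep as [i = s n + t], so on
    [n <= N] it stays below the latter as soon as it does at [n = N].
    Moreover [s - eps < (I + 1) / (N + 1) <= s], so vanishing with slope
    [(I + 1) / (N + 1)] is already a consequence of the hypothesis, without the
    theorem that extends vanishing from a staircase to a line. *)

Lemma finite_staircase (N I : nat) :
  finite_set [set p : nat * nat | in_staircase N I p.1 p.2].
Proof.
apply: (@sub_finite_set _ _ (`I_N.+1 `*` `I_I.+1)); last first.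
  by apply: finite_setX; exact: finite_II.
by case=> n i [/= _ nN iI]; split=> /=; [exact: nN | lia].
Qed.

Lemma vanishes_with_slope_le (R : realType) (V : braidedVectSpace R[i])
    (s s' : R) :
  s' <= s -> vanishes_with_slope V s -> vanishes_with_slope V s'.
Proof.
move=> s's [t Vt]; exists t => n i n_gt0 it; apply: Vt => //.
by rewrite (le_trans it)// lerD2r ler_wpM2r.
Qed.

Lemma vanishes_in_staircase_below_line (R : realType)
    (V : braidedVectSpace R[i]) (s t : R) (N I : nat) :
  s <= 1 ->
  (forall n i : nat, (1 <= n)%N -> i%:R <= s * n%:R + t ->
     homology_vanishes V n i) ->
  I%:R <= s * N%:R + t -> vanishes_in_staircase V N I.
Proof.
move=> s_le1 Vt It n i [n_gt0 nN iI]; apply: Vt => //.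
have iNIn : i%:R + N%:R <= I%:R + n%:R :> R by rewrite -!natrD ler_nat; lia.
have nNR : n%:R <= N%:R :> R by rewrite ler_nat.
(* The product needed is [(1 - s) * (N - n) >= 0]. *)
nra.
Qed.

Theorem corollary1p4 (R : realType) (V : braidedVectSpace R[i]) (s : R)
    (s_gt0 : 0 < s) (s_le1 : s <= 1) (V_slope : vanishes_with_slope V s)
    (eps : R) (eps_gt0 : 0 < eps) :
  exists N I : nat,
    [/\ (2 <= N)%N,
        vanishes_in_staircase V N I,
        s - eps < I.+1%:R / N.+1%:R,
        finite_set [set p : nat * nat | in_staircase N I p.1 p.2] &
        vanishes_with_slope V (I.+1%:R / N.+1%:R)].
Proof.
have [t Vt] := V_slope.
have t_ge0 := normr_ge0 t.
have t_geN : - `|t| <= t by rewrite lerNl -normrN ler_norm.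
(* The first summand will give [y >= 0], so that [truncn y] is a true floor; the second will push
   the slope above [s - eps]. *)
pose x := (`|t| + 1) / s + (`|t| + 2) / eps.
have xs_ge0 : 0 <= (`|t| + 1) / s by rewrite divr_ge0 ?ltW//; lra.
have xe_ge0 : 0 <= (`|t| + 2) / eps by rewrite divr_ge0 ?ltW//; lra.
pose N := (Num.truncn x).+2.
have xN : x < N%:R.
  by rewrite (lt_trans (truncnS_gt x))// ltr_nat.
have sN : `|t| + 1 <= s * N%:R.
  by rewrite mulrC -ler_pdivrMr//; rewrite /x in xN; lra.
have eN : `|t| + 2 < eps * N%:R.
  by rewrite mulrC -ltr_pdivrMr//; rewrite /x in xN; lra.
(* The [- 1] ensures [I + 1 <= s * N], which keeps the slope at most [s]. *)
pose y := s * N%:R - `|t| - 1.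
have y_ge0 : 0 <= y by rewrite /y; lra.
pose I := Num.truncn y.
have /andP[Iy yI] : I%:R <= y < I.+1%:R by exact: truncn_itv.
have IS : I.+1%:R = I%:R + 1 :> R by rewrite -natr1.
have NS : N.+1%:R = N%:R + 1 :> R by rewrite -natr1.
rewrite /y in Iy yI.
exists N, I; split => //.
- by apply: (vanishes_in_staircase_below_line _ _ s t) => //; lra.
(* In [|t| + 2 < eps * N], [|t| + 1] absorbs the shift in [y], and the remaining 1 the term [s <= 1]
   of [s * (N + 1)]. *)
- by rewrite ltr_pdivlMr ?ltr0Sn// NS; nra.
- exact: finite_staircase.
- apply: vanishes_with_slope_le V_slope.
  by rewrite ler_pdivrMr ?ltr0Sn// NS IS; lra.
Qed.
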